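(* Let $\mathbf T=(T,m^T,e^T)$ be a monad on a category $\mathbb A$, $\mathbf G$ a comonad on $\mathbb A_{\mathbf T}$, and $K:\mathbb A\to(\mathbb A_{\mathbf T})^{\mathbf G}$ a functor with $U^{\mathbf G}K=\phi_{\mathbf T}$ that has a right adjoint $\overline K:(\mathbb A_{\mathbf T})^{\mathbf G}\to\mathbb A$. Let $\mathbf P$ be the monad on $\mathbb A$ generated by the adjunction $K\dashv\overline K$, $\iota:\mathbf P\to\mathbf T$ the induced morphism of monads, and $K_{\mathbf P}:(\mathbb A_{\mathbf T})^{\mathbf G}\to\mathbb A_{\mathbf P}$ the Eilenberg–Moore comparison functor. Then $K_{\mathbf P}$ admits a left adjoint $L_{\mathbf P}:\mathbb A_{\mathbf P}\to(\mathbb A_{\mathbf T})^{\mathbf G}$ if and only if the restriction-of-base functor $\iota^*:\mathbb A_{\mathbf T}\to\mathbb A_{\mathbf P}$ admits a left adjoint, i.e. the change-of-base functor $\iota_!:\mathbb A_{\mathbf P}\to\mathbb A_{\mathbf T}$ exists. Moreover, when this is the case, $\iota_!=U^{\mathbf G}L_{\mathbf P}$.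
   Context: $\mathbb A_{\mathbf T}$ is the Eilenberg–Moore category of $\mathbf T$-modules, $\phi_{\mathbf T}:\mathbb A\to\mathbb A_{\mathbf T}$ the free and $U_{\mathbf T}:\mathbb A_{\mathbf T}\to\mathbb A$ the forgetful functor; $(\mathbb A_{\mathbf T})^{\mathbf G}$ is the category of $\mathbf G$-comodules in $\mathbb A_{\mathbf T}$ and $U^{\mathbf G}$ its forgetful functor. If $\overline\eta,\overline\sigma$ are the unit and counit of $K\dashv\overline K$, then $\mathbf P=(\overline KK,\overline K\,\overline\sigma K,\overline\eta)$ and $K_{\mathbf P}(x)=(\overline K(x),\overline K(\overline\sigma_x))$. The monad morphism $\iota:P\to T$ has components $\iota_a:P(a)\xrightarrow{e^T_{P(a)}}TP(a)=U_{\mathbf T}U^{\mathbf G}K\overline KK(a)\xrightarrow{U_{\mathbf T}U^{\mathbf G}(\overline\sigma_{K(a)})}U_{\mathbf T}U^{\mathbf G}K(a)=T(a)$. The restriction-of-base functor is $\iota^*(a,h)=(a,h\cdot\iota_a)$, and $\iota_!$ denotes its left adjoint. Equality of left adjoints is understood up to the canonical isomorphism. *)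

(* Defs.v *)
From Stdlib Require Import ProofIrrelevance.

Set Implicit Arguments.
Unset Strict Implicit.
Unset Printing Implicit Defensive.

Declare Scope cat_scope.
Delimit Scope cat_scope with cat.
Local Open Scope cat_scope.
#[local] Obligation Tactic := idtac.

Reserved Notation "g ∘ f" (at level 40, left associativity).
Reserved Notation "G ⊙ F" (at level 40, left associativity).

Record Category := {
  Ob :> Type;
  Hom : Ob -> Ob -> Type;
  idm : forall x, Hom x x;
  comp : forall x y z, Hom y z -> Hom x y -> Hom x z;
  comp_idl : forall x y (f : Hom x y), comp (idm y) f = f;
  comp_idr : forall x y (f : Hom x y), comp f (idm x) = f;
  comp_assoc : forall x y z w (h : Hom z w) (g : Hom y z) (f : Hom x y),
    comp h (comp g f) = comp (comp h g) f }.

Arguments Hom {c} x y.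
Arguments idm {c} x.
Arguments comp {c x y z} g f.
Notation "g ∘ f" := (comp g f) : cat_scope.

Record Functor (C D : Category) := {
  fobj :> C -> D;
  fmap : forall x y : C, Hom x y -> Hom (fobj x) (fobj y);
  fmap_id : forall x, fmap (idm x) = idm (fobj x);
  fmap_comp : forall x y z (g : Hom y z) (f : Hom x y),
    fmap (g ∘ f) = fmap g ∘ fmap f }.

Arguments fmap {C D} F {x y} f : rename.

Definition id_functor (C : Category) : Functor C C := {|
  fobj := fun x => x;
  fmap := fun _ _ f => f;
  fmap_id := fun _ => eq_refl;
  fmap_comp := fun _ _ _ _ _ => eq_refl |}.

Program Definition comp_functor (C D E : Category)
    (G : Functor D E) (F : Functor C D) : Functor C E := {|
  fobj := fun x => G (F x);
  fmap := fun _ _ f => fmap G (fmap F f) |}.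
Next Obligation. simpl; now intros; rewrite !fmap_id. Qed.
Next Obligation. simpl; now intros; rewrite !fmap_comp. Qed.

Notation "G ⊙ F" := (comp_functor G F) : cat_scope.

Record NatTrans (C D : Category) (F G : Functor C D) := {
  ntc :> forall x : C, Hom (F x) (G x);
  ntc_nat : forall (x y : C) (f : Hom x y), ntc y ∘ fmap F f = fmap G f ∘ ntc x }.

Program Definition id_nat (C D : Category) (F : Functor C D) : NatTrans F F := {|
  ntc := fun x => idm (F x) |}.
Next Obligation. simpl; now intros; rewrite comp_idl, comp_idr. Qed.

Record NatIso (C D : Category) (F G : Functor C D) := {
  iso_to :> NatTrans F G;
  iso_from : NatTrans G F;
  iso_from_to : forall x, iso_from x ∘ iso_to x = idm (F x);
  iso_to_from : forall x, iso_to x ∘ iso_from x = idm (G x) }.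

(* An equality of functors does not make the values definitionally equal; it is
   used through the identity transformation transported along it. *)
Definition eq_nat (C D : Category) (F G : Functor C D) (e : F = G) : NatTrans F G :=
  match e in _ = H return NatTrans F H with eq_refl => id_nat F end.

Lemma eq_nat_symK (C D : Category) (F G : Functor C D) (e : F = G) (x : C) :
  eq_nat e x ∘ eq_nat (eq_sym e) x = idm (G x).
Proof. destruct e; apply comp_idl. Qed.

Lemma eq_natK (C D : Category) (F G : Functor C D) (e : F = G) (x : C) :
  eq_nat (eq_sym e) x ∘ eq_nat e x = idm (F x).
Proof. destruct e; apply comp_idl. Qed.

Record Adjunction (C D : Category) (L : Functor C D) (R : Functor D C) := {
  adj_unit : NatTrans (id_functor C) (R ⊙ L);
  adj_counit : NatTrans (L ⊙ R) (id_functor D);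
  adj_triL : forall x : C, adj_counit (L x) ∘ fmap L (adj_unit x) = idm (L x);
  adj_triR : forall y : D, fmap R (adj_counit y) ∘ adj_unit (R y) = idm (R y) }.

Definition has_left_adjoint (C D : Category) (R : Functor D C) : Prop :=
  exists L : Functor C D, inhabited (Adjunction L R).

Record Monad (C : Category) := {
  mfun :> Functor C C;
  mmul : NatTrans (mfun ⊙ mfun) mfun;
  munit : NatTrans (id_functor C) mfun;
  mmul_unitl : forall x, mmul x ∘ munit (mfun x) = idm (mfun x);
  mmul_unitr : forall x, mmul x ∘ fmap mfun (munit x) = idm (mfun x);
  mmul_assoc : forall x, mmul x ∘ mmul (mfun x) = mmul x ∘ fmap mfun (mmul x) }.

Record MonadMorphism (C : Category) (P T : Monad C) := {
  mm :> NatTrans P T;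
  mm_unit : forall x, mm x ∘ munit P x = munit T x;
  mm_mul : forall x, mm x ∘ mmul P x = mmul T x ∘ (fmap T (mm x) ∘ mm (P x)) }.

Record Module (C : Category) (T : Monad C) := {
  mcarrier : C;
  maction : Hom (T mcarrier) mcarrier;
  maction_unit : maction ∘ munit T mcarrier = idm mcarrier;
  maction_mul : maction ∘ mmul T mcarrier = maction ∘ fmap T maction }.

Record ModuleHom (C : Category) (T : Monad C) (M N : Module T) := {
  mhom : Hom (mcarrier M) (mcarrier N);
  mhom_action : mhom ∘ maction M = maction N ∘ fmap T mhom }.

Lemma mhom_inj (C : Category) (T : Monad C) (M N : Module T) (f g : ModuleHom M N) :
  mhom f = mhom g -> f = g.
Proof.
destruct f as [f hf], g as [g hg]; simpl; intros e; subst g.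
f_equal; apply proof_irrelevance.
Qed.

Program Definition EM (C : Category) (T : Monad C) : Category := {|
  Ob := Module T;
  Hom := @ModuleHom C T;
  idm := fun M => {| mhom := idm (mcarrier M) |};
  comp := fun _ _ _ g f => {| mhom := mhom g ∘ mhom f |} |}.
Next Obligation. simpl; now intros; rewrite fmap_id, comp_idl, comp_idr. Qed.
Next Obligation. simpl.
intros; rewrite fmap_comp, <- comp_assoc, mhom_action, !comp_assoc.
now rewrite mhom_action.
Qed.
Next Obligation. simpl; intros; apply mhom_inj, comp_idl. Qed.
Next Obligation. simpl; intros; apply mhom_inj, comp_idr. Qed.
Next Obligation. simpl; intros; apply mhom_inj, comp_assoc. Qed.

Definition EM_forget (C : Category) (T : Monad C) : Functor (EM T) C := {|
  fobj := fun M : EM T => mcarrier M;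
  fmap := fun _ _ f => mhom f;
  fmap_id := fun _ => eq_refl;
  fmap_comp := fun _ _ _ _ _ => eq_refl |}.

Program Definition EM_free (C : Category) (T : Monad C) : Functor C (EM T) := {|
  fobj := fun x => {| mcarrier := T x; maction := mmul T x |} : EM T;
  fmap := fun _ _ f => {| mhom := fmap T f |} |}.
Next Obligation. simpl; intros; apply mmul_unitl. Qed.
Next Obligation. simpl; intros; apply mmul_assoc. Qed.
Next Obligation. simpl; intros; symmetry; apply (ntc_nat (mmul T)). Qed.
Next Obligation. simpl; intros; apply mhom_inj, fmap_id. Qed.
Next Obligation. simpl; intros; apply mhom_inj, fmap_comp. Qed.

Record Comonad (C : Category) := {
  cfun :> Functor C C;
  comul : NatTrans cfun (cfun ⊙ cfun);
  counit : NatTrans cfun (id_functor C);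
  comul_counitl : forall x, counit (cfun x) ∘ comul x = idm (cfun x);
  comul_counitr : forall x, fmap cfun (counit x) ∘ comul x = idm (cfun x);
  comul_assoc : forall x, comul (cfun x) ∘ comul x = fmap cfun (comul x) ∘ comul x }.

Record Comodule (C : Category) (G : Comonad C) := {
  ccarrier : C;
  coaction : Hom ccarrier (G ccarrier);
  coaction_counit : counit G ccarrier ∘ coaction = idm ccarrier;
  coaction_comul : comul G ccarrier ∘ coaction = fmap G coaction ∘ coaction }.

Record ComoduleHom (C : Category) (G : Comonad C) (M N : Comodule G) := {
  chom : Hom (ccarrier M) (ccarrier N);
  chom_coaction : coaction N ∘ chom = fmap G chom ∘ coaction M }.

Lemma chom_inj (C : Category) (G : Comonad C) (M N : Comodule G)
    (f g : ComoduleHom M N) : chom f = chom g -> f = g.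
Proof.
destruct f as [f hf], g as [g hg]; simpl; intros e; subst g.
f_equal; apply proof_irrelevance.
Qed.

Program Definition coEM (C : Category) (G : Comonad C) : Category := {|
  Ob := Comodule G;
  Hom := @ComoduleHom C G;
  idm := fun M => {| chom := idm (ccarrier M) |};
  comp := fun _ _ _ g f => {| chom := chom g ∘ chom f |} |}.
Next Obligation. simpl; now intros; rewrite fmap_id, comp_idl, comp_idr. Qed.
Next Obligation. simpl.
intros; rewrite fmap_comp, comp_assoc, chom_coaction, <- !comp_assoc.
now rewrite chom_coaction.
Qed.
Next Obligation. simpl; intros; apply chom_inj, comp_idl. Qed.
Next Obligation. simpl; intros; apply chom_inj, comp_idr. Qed.
Next Obligation. simpl; intros; apply chom_inj, comp_assoc. Qed.

Definition coEM_forget (C : Category) (G : Comonad C) : Functor (coEM G) C := {|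
  fobj := fun M : coEM G => ccarrier M;
  fmap := fun _ _ f => chom f;
  fmap_id := fun _ => eq_refl;
  fmap_comp := fun _ _ _ _ _ => eq_refl |}.

Program Definition restriction (C : Category) (P T : Monad C)
    (i : MonadMorphism P T) : Functor (EM T) (EM P) := {|
  fobj := fun M => {| mcarrier := mcarrier M;
                      maction := maction M ∘ i (mcarrier M) |} : EM P;
  fmap := fun M N f => {| mhom := mhom f |} |}.
Next Obligation. simpl.
intros; rewrite <- comp_assoc.
pose proof (mm_unit i (mcarrier M)) as E; simpl in E; rewrite E.
apply maction_unit.
Qed.
Next Obligation. simpl.
intros; rewrite <- comp_assoc.
pose proof (mm_mul i (mcarrier M)) as E0; simpl in E0; rewrite E0.
pose proof (maction_mul M) as E1; simpl in E1; rewrite !comp_assoc, E1.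
rewrite <- !comp_assoc; f_equal.
pose proof (ntc_nat i (maction M ∘ i (mcarrier M))) as E; simpl in E.
now rewrite E, fmap_comp, comp_assoc.
Qed.
Next Obligation. simpl.
intros; pose proof (ntc_nat i (mhom f)) as E; simpl in E.
now rewrite <- comp_assoc, E, !comp_assoc, mhom_action.
Qed.
Next Obligation. simpl; now intros; apply mhom_inj. Qed.
Next Obligation. simpl; now intros; apply mhom_inj. Qed.

Section AdjunctionMonad.
Variables (C D : Category) (L : Functor C D) (R : Functor D C).
Variable adj : Adjunction L R.

Program Definition adj_monad : Monad C := {|
  mfun := R ⊙ L;
  mmul := {| ntc := fun x => fmap R (adj_counit adj (L x)) |};
  munit := adj_unit adj |}.
Next Obligation. simpl.
intros; simpl; rewrite <- !fmap_comp; f_equal.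
apply (ntc_nat (adj_counit adj) (fmap L f)).
Qed.
Next Obligation. simpl; intros; apply adj_triR. Qed.
Next Obligation. simpl.
intros; simpl; pose proof (adj_triL adj x) as E; simpl in E.
now rewrite <- fmap_comp, E, fmap_id.
Qed.
Next Obligation. simpl.
intros; simpl; rewrite <- !fmap_comp; f_equal; symmetry.
apply (ntc_nat (adj_counit adj) (adj_counit adj (L x))).
Qed.

Program Definition comparison : Functor D (EM adj_monad) := {|
  fobj := fun y => {| mcarrier := R y;
                      maction := fmap R (adj_counit adj y) |} : EM adj_monad;
  fmap := fun _ _ f => {| mhom := fmap R f |} |}.
Next Obligation. simpl; intros; apply adj_triR. Qed.
Next Obligation. simpl.
intros; simpl; rewrite <- !fmap_comp; f_equal; symmetry.
apply (ntc_nat (adj_counit adj) (adj_counit adj y)).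
Qed.
Next Obligation. simpl.
intros; simpl; rewrite <- !fmap_comp; f_equal; symmetry.
apply (ntc_nat (adj_counit adj) f).
Qed.
Next Obligation. simpl; intros; apply mhom_inj, fmap_id. Qed.
Next Obligation. simpl; intros; apply mhom_inj, fmap_comp. Qed.
End AdjunctionMonad.

Section Induced.
Variables (A : Category) (T : Monad A) (G : Comonad (EM T)).
Variables (K : Functor A (coEM G)) (eK : coEM_forget G ⊙ K = EM_free T).
Variables (Kbar : Functor (coEM G) A) (adj : Adjunction K Kbar).

#[local] Definition U : Functor (coEM G) A := EM_forget T ⊙ coEM_forget G.
#[local] Definition toT (a : A) : Hom (U (K a)) (T a) :=
  fmap (EM_forget T) (eq_nat eK a).
#[local] Definition ofT (a : A) : Hom (T a) (U (K a)) :=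
  fmap (EM_forget T) (eq_nat (eq_sym eK) a).

#[local] Definition e (a : A) : Hom a (T a) := munit T a.
#[local] Definition m (a : A) : Hom (T (T a)) (T a) := mmul T a.
#[local] Definition s (x : coEM G) : Hom (K (Kbar x)) x := adj_counit adj x.
#[local] Definition u (a : A) : Hom a (Kbar (K a)) := adj_unit adj a.

#[local] Lemma toT_nat (a b : A) (f : Hom a b) : toT b ∘ fmap U (fmap K f) = fmap T f ∘ toT a.
Proof. exact (f_equal (fun h => mhom h) (ntc_nat (eq_nat eK) f)). Qed.
#[local] Lemma ofT_nat (a b : A) (f : Hom a b) : ofT b ∘ fmap T f = fmap U (fmap K f) ∘ ofT a.
Proof. exact (f_equal (fun h => mhom h) (ntc_nat (eq_nat (eq_sym eK)) f)). Qed.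
#[local] Lemma toTK (a : A) : toT a ∘ ofT a = idm (T a).
Proof. exact (f_equal (fun h => mhom h) (eq_nat_symK eK a)). Qed.
#[local] Lemma ofTK (a : A) : ofT a ∘ toT a = idm (U (K a)).
Proof. exact (f_equal (fun h => mhom h) (eq_natK eK a)). Qed.
#[local] Lemma e_nat (a b : A) (f : Hom a b) : e b ∘ f = fmap T f ∘ e a.
Proof. exact (ntc_nat (munit T) f). Qed.
#[local] Lemma s_nat (x y : coEM G) (f : Hom x y) : s y ∘ fmap K (fmap Kbar f) = f ∘ s x.
Proof. exact (ntc_nat (adj_counit adj) f). Qed.
#[local] Lemma s_u (a : A) : s (K a) ∘ fmap K (u a) = idm (K a).
Proof. exact (adj_triL adj a). Qed.

(* For x = K a this is iota_a before the final identification U_T U^G K a = T a. *)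
Definition mate_map (x : coEM G) : Hom (Kbar x) (mcarrier (ccarrier x)) :=
  fmap (EM_forget T) (fmap (coEM_forget G) (adj_counit adj x)) ∘
  (fmap (EM_forget T) (eq_nat (eq_sym eK) (Kbar x)) ∘ munit T (Kbar x)).

#[local] Definition mt (x : coEM G) : Hom (Kbar x) (U x) := mate_map x.

#[local] Lemma mtE (x : coEM G) : mt x = fmap U (s x) ∘ (ofT (Kbar x) ∘ e (Kbar x)).
Proof. reflexivity. Qed.

#[local] Lemma mt_nat (x y : coEM G) (f : Hom x y) :
  mt y ∘ fmap Kbar f = fmap U f ∘ mt x.
Proof.
rewrite !mtE, <- !comp_assoc, e_nat, (comp_assoc (ofT _)), ofT_nat.
now rewrite !comp_assoc, <- !fmap_comp, s_nat.
Qed.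

Definition iota_map (a : A) : Hom (Kbar (K a)) (T a) :=
  fmap (EM_forget T) (eq_nat eK a) ∘ mate_map (K a).

#[local] Lemma iota_mapE (a : A) : iota_map a = toT a ∘ mt (K a).
Proof. reflexivity. Qed.

#[local] Lemma iota_map_nat (a b : A) (f : Hom a b) :
  iota_map b ∘ fmap Kbar (fmap K f) = fmap T f ∘ iota_map a.
Proof.
rewrite !iota_mapE, <- comp_assoc, mt_nat.
now rewrite !comp_assoc, toT_nat.
Qed.

#[local] Lemma iota_map_unit (a : A) : iota_map a ∘ u a = e a.
Proof.
rewrite iota_mapE, mtE, <- !comp_assoc, e_nat, (comp_assoc (ofT _)), ofT_nat.
rewrite <- comp_assoc, (comp_assoc (fmap U _)), <- fmap_comp, s_u, fmap_id, comp_idl.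
now rewrite comp_assoc, toTK, comp_idl.
Qed.

#[local] Definition act (x : coEM G) : Hom (T (U x)) (U x) := maction (ccarrier x).

#[local] Lemma mate_ext (x : coEM G) : act x ∘ fmap T (mt x) = fmap U (s x) ∘ ofT (Kbar x).
Proof.
pose (h := comp (c := EM T) (chom (s x)) (eq_nat (eq_sym eK) (Kbar x))).
assert (E : fmap U (s x) ∘ ofT (Kbar x) ∘ m (Kbar x)
    = act x ∘ fmap T (fmap U (s x) ∘ ofT (Kbar x))) by exact (mhom_action h).
assert (E1 : m (Kbar x) ∘ fmap T (e (Kbar x)) = idm (T (Kbar x)))
  by exact (mmul_unitr T (Kbar x)).
rewrite mtE, comp_assoc, fmap_comp, comp_assoc, <- E, <- comp_assoc.
now rewrite E1, comp_idr.
Qed.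

#[local] Lemma mate_mul (x : coEM G) :
  mt x ∘ fmap Kbar (s x) = act x ∘ fmap T (mt x) ∘ iota_map (Kbar x).
Proof.
rewrite mt_nat, mate_ext, iota_mapE.
now rewrite !comp_assoc, <- (comp_assoc _ (ofT _)), ofTK, comp_idr.
Qed.

#[local] Lemma iota_map_mul (a : A) :
  iota_map a ∘ fmap Kbar (s (K a))
  = m a ∘ (fmap T (iota_map a) ∘ iota_map (Kbar (K a))).
Proof.
assert (E : toT a ∘ act (K a) = m a ∘ fmap T (toT a))
  by exact (mhom_action (eq_nat eK a)).
rewrite (iota_mapE a), <- comp_assoc, mate_mul, fmap_comp.
now rewrite !comp_assoc, E.
Qed.

Definition iota : MonadMorphism (adj_monad adj) T := {|
  mm := {| ntc := iota_map : forall a, Hom (adj_monad adj a) (T a);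
           ntc_nat := iota_map_nat |};
  mm_unit := iota_map_unit;
  mm_mul := iota_map_mul |}.

#[local] Lemma mate_action (x : coEM G) :
  mt x ∘ fmap Kbar (s x) = act x ∘ iota_map (U x) ∘ fmap Kbar (fmap K (mt x)).
Proof. now rewrite <- comp_assoc, iota_map_nat, comp_assoc, mate_mul. Qed.

Definition mate_hom (x : coEM G) :
    Hom (comparison adj x) ((restriction iota ⊙ coEM_forget G) x) :=
  Build_ModuleHom (M := comparison adj x)
    (N := (restriction iota ⊙ coEM_forget G) x) (mhom := mate_map x) (mate_action x).

#[local] Lemma mate_hom_nat (x y : coEM G) (f : Hom x y) :
  mate_hom y ∘ fmap (comparison adj) f
  = fmap (restriction iota ⊙ coEM_forget G) f ∘ mate_hom x.
Proof. apply mhom_inj; exact (mt_nat f). Qed.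

(* The mate K_P => iota^* U^G of the equality U^G K = phi_T. At cofree comodules
   it gives K_P phi^G = iota^* (up to isomorphism), so composing it with the unit of
   L_P -| K_P gives the unit of the composite adjunction U^G L_P -| iota^*. *)
Definition mate : NatTrans (comparison adj) (restriction iota ⊙ coEM_forget G) := {|
  ntc := mate_hom;
  ntc_nat := mate_hom_nat |}.
End Induced.

(* Main.v *)
(* Every comodule [x] is the equalizer of a pair of cofree comodules, and the
   comparison functor [K_P] preserves these equalizers because [Kbar] is a right
   adjoint. Moreover [K_P] composed with the cofree comodule functor is isomorphic
   to the restriction functor, both being carried by right adjoints of the free module
   functor. A left adjoint of [K_P] hence composes with the forgetful functor of
   comodules to a left adjoint of restriction; conversely a left adjoint of
   restriction acquires a coaction and lifts along the equalizers (Dubuc's adjoint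
   triangle). *)
Require Import Defs.
Local Open Scope cat_scope.
#[local] Obligation Tactic := idtac.

(** * Adjunctions and transposition *)

(* [adj_unit] and [adj_counit] at types free of [id_functor] and [⊙], so that
   rewriting works up to syntactic equality. *)
Definition unit_at {C D : Category} {L : Functor C D} {R : Functor D C}
    (adj : Adjunction L R) (x : C) : Hom x (R (L x)) := adj_unit adj x.

Definition counit_at {C D : Category} {L : Functor C D} {R : Functor D C}
    (adj : Adjunction L R) (y : D) : Hom (L (R y)) y := adj_counit adj y.

Lemma unit_nat {C D : Category} {L : Functor C D} {R : Functor D C}
    (adj : Adjunction L R) {x y : C} (f : Hom x y) :
  unit_at adj y ∘ f = fmap R (fmap L f) ∘ unit_at adj x.
Proof. apply (ntc_nat (adj_unit adj)). Qed.

Lemma counit_nat {C D : Category} {L : Functor C D} {R : Functor D C}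
    (adj : Adjunction L R) {x y : D} (f : Hom x y) :
  counit_at adj y ∘ fmap L (fmap R f) = f ∘ counit_at adj x.
Proof. apply (ntc_nat (adj_counit adj)). Qed.

Lemma counit_unit {C D : Category} {L : Functor C D} {R : Functor D C}
    (adj : Adjunction L R) (x : C) :
  counit_at adj (L x) ∘ fmap L (unit_at adj x) = idm (L x).
Proof. apply adj_triL. Qed.

Lemma unit_counit {C D : Category} {L : Functor C D} {R : Functor D C}
    (adj : Adjunction L R) (y : D) :
  fmap R (counit_at adj y) ∘ unit_at adj (R y) = idm (R y).
Proof. apply adj_triR. Qed.

Definition transpose {C D : Category} {L : Functor C D} {R : Functor D C}
    (adj : Adjunction L R) {x : C} {y : D} (f : Hom x (R y)) : Hom (L x) y :=
  counit_at adj y ∘ fmap L f.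

Lemma transpose_unit {C D : Category} {L : Functor C D} {R : Functor D C}
    (adj : Adjunction L R) {x : C} {y : D} (f : Hom x (R y)) :
  fmap R (transpose adj f) ∘ unit_at adj x = f.
Proof.
unfold transpose.
now rewrite fmap_comp, <- comp_assoc, <- unit_nat, comp_assoc, unit_counit, comp_idl.
Qed.

Lemma transposeK {C D : Category} {L : Functor C D} {R : Functor D C}
    (adj : Adjunction L R) {x : C} {y : D} (g : Hom (L x) y) :
  transpose adj (fmap R g ∘ unit_at adj x) = g.
Proof.
unfold transpose.
now rewrite fmap_comp, comp_assoc, counit_nat, <- comp_assoc, counit_unit, comp_idr.
Qed.

Lemma unit_inj {C D : Category} {L : Functor C D} {R : Functor D C}
    (adj : Adjunction L R) {x : C} {y : D} (g g' : Hom (L x) y) :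
  fmap R g ∘ unit_at adj x = fmap R g' ∘ unit_at adj x -> g = g'.
Proof. now intros E; rewrite <- (transposeK adj g), E, transposeK. Qed.

Lemma transpose_inj {C D : Category} {L : Functor C D} {R : Functor D C}
    (adj : Adjunction L R) {x : C} {y : D} (f f' : Hom x (R y)) :
  transpose adj f = transpose adj f' -> f = f'.
Proof.
now intros E; rewrite <- (transpose_unit adj f), E, transpose_unit.
Qed.

Lemma transpose_comp {C D : Category} {L : Functor C D} {R : Functor D C}
    (adj : Adjunction L R) {x : C} {y z : D} (f : Hom x (R y)) (g : Hom y z) :
  transpose adj (fmap R g ∘ f) = g ∘ transpose adj f.
Proof.
unfold transpose; rewrite fmap_comp, !comp_assoc; f_equal.
apply counit_nat.
Qed.

(** * Adjunctions from universal arrows, and their uniqueness *)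

(** The counit is the transpose of the identity; [eta_inj] reduces its naturality and the left
    triangle law to computations after composing with [eta]. The conclusion keeps track of the unit
    because the unit of the adjunction on [restriction] has to be a prescribed composite. *)
Lemma adjunction_of_universal {C D : Category} (L : Functor C D) (R : Functor D C)
    (eta : NatTrans (id_functor C) (R ⊙ L))
    (tr : forall (p : C) (y : D), Hom p (R y) -> Hom (L p) y)
    (tr_eta : forall p y (f : Hom p (R y)), fmap R (tr p y f) ∘ eta p = f)
    (eta_inj : forall p y (g g' : Hom (L p) y),
      fmap R g ∘ eta p = fmap R g' ∘ eta p -> g = g') :
  exists adj : Adjunction L R, forall p, adj_unit adj p = eta p.
Proof.
simpl in tr_eta, eta_inj.
assert (nat : forall (x y : D) (f : Hom x y),
    tr (R y) y (idm (R y)) ∘ fmap L (fmap R f) = f ∘ tr (R x) x (idm (R x))).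
{ intros x y f; apply eta_inj; rewrite !fmap_comp, <- !comp_assoc; simpl; rewrite tr_eta.
  pose proof (ntc_nat eta (fmap R f)) as E; simpl in E |- *.
  now rewrite <- E, comp_assoc, tr_eta, comp_idl, comp_idr. }
unshelve eexists {|
  adj_unit := eta;
  adj_counit := {| ntc := fun y => tr (R y) y (idm (R y)) : Hom ((L ⊙ R) y) (id_functor D y);
                   ntc_nat := nat |} |}.
- intros x; apply eta_inj; simpl; rewrite fmap_comp, fmap_id, <- comp_assoc.
  pose proof (ntc_nat eta (eta x)) as E; simpl in E |- *.
  now rewrite <- E, comp_assoc, tr_eta.
- intros y; apply tr_eta.
- reflexivity.
Qed.

(** [L] is given on objects only: its action on [f] is forced to be the transpose of [eta y ∘ f],
    and functoriality follows from uniqueness of transposes. *)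
Lemma has_left_adjoint_of_universal {C D : Category} (R : Functor D C)
    (L : C -> D) (eta : forall p, Hom p (R (L p)))
    (tr : forall (p : C) (y : D), Hom p (R y) -> Hom (L p) y)
    (tr_eta : forall p y (f : Hom p (R y)), fmap R (tr p y f) ∘ eta p = f)
    (eta_inj : forall p y (g g' : Hom (L p) y),
      fmap R g ∘ eta p = fmap R g' ∘ eta p -> g = g') :
  has_left_adjoint R.
Proof.
pose (fm := fun (x y : C) (f : Hom x y) => tr x (L y) (eta y ∘ f)).
assert (fm_id : forall x, fm x x (idm x) = idm (L x)).
{ intros x; apply eta_inj; unfold fm.
  now rewrite tr_eta, fmap_id, comp_idl, comp_idr. }
assert (fm_comp : forall x y z (g : Hom y z) (f : Hom x y),
    fm x z (g ∘ f) = fm y z g ∘ fm x y f).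
{ intros x y z g f; apply eta_inj; unfold fm.
  now rewrite fmap_comp, <- comp_assoc, !tr_eta, !comp_assoc, tr_eta. }
pose (F := Build_Functor fm_id fm_comp).
assert (nat : forall x y (f : Hom x y), eta y ∘ f = fmap R (fm x y f) ∘ eta x)
  by (intros x y f; symmetry; apply tr_eta).
pose (n := Build_NatTrans (F := id_functor C) (G := R ⊙ F) nat).
destruct (adjunction_of_universal F R n tr tr_eta eta_inj) as [adj _].
now exists F; constructor.
Qed.

Lemma has_left_adjoint_iso {C D : Category} {R R' : Functor D C} (i : NatIso R R') :
  has_left_adjoint R' -> has_left_adjoint R.
Proof.
intros [L [adj]].
apply (has_left_adjoint_of_universal R L
  (fun p => iso_from i (L p) ∘ unit_at adj p)
  (fun p y f => transpose adj (i y ∘ f))).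
- intros p y f; rewrite comp_assoc, <- ntc_nat, <- comp_assoc, transpose_unit.
  now rewrite comp_assoc, iso_from_to, comp_idl.
- intros p y g g'; rewrite !comp_assoc, <- !ntc_nat, <- !comp_assoc; intros E.
  apply (unit_inj adj).
  rewrite <- (comp_idl (fmap R' g ∘ _)), <- (comp_idl (fmap R' g' ∘ _)).
  now rewrite <- (iso_to_from i), <- !comp_assoc, E.
Qed.

Lemma left_adjoint_unique {C D : Category} {L L' : Functor C D} {R : Functor D C}
    (adj : Adjunction L R) (adj' : Adjunction L' R) :
  exists alpha : NatIso L L', forall p,
    fmap R (alpha p) ∘ adj_unit adj p = adj_unit adj' p.
Proof.
(* Stated for arbitrary [M] and [N], so that each of [nat] and [inv] serves both directions of the
   isomorphism. *)
assert (nat : forall (M N : Functor C D) (a : Adjunction M R) (b : Adjunction N R)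
    (x y : C) (f : Hom x y),
    transpose a (unit_at b y) ∘ fmap M f = fmap N f ∘ transpose a (unit_at b x)).
{ intros M N a b x y f; apply (unit_inj a).
  rewrite !fmap_comp, <- !comp_assoc, transpose_unit.
  now rewrite <- !unit_nat, comp_assoc, transpose_unit. }
assert (inv : forall (M N : Functor C D) (a : Adjunction M R) (b : Adjunction N R) (x : C),
    transpose b (unit_at a x) ∘ transpose a (unit_at b x) = idm (M x)).
{ intros M N a b x; apply (unit_inj a).
  now rewrite fmap_comp, <- comp_assoc, !transpose_unit, fmap_id, comp_idl. }
exists {| iso_to := Build_NatTrans (nat L L' adj adj');
          iso_from := Build_NatTrans (nat L' L adj' adj);
          iso_from_to := inv L L' adj adj';
          iso_to_from := inv L' L adj' adj |}.
intros p; apply transpose_unit.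
Qed.

(** * Cofree comodules and the equalizer presentation of a comodule *)

Definition extract_at {C : Category} (G : Comonad C) (x : C) : Hom (G x) x :=
  counit G x.

Definition duplicate_at {C : Category} (G : Comonad C) (x : C) : Hom (G x) (G (G x)) :=
  comul G x.

Lemma extract_nat {C : Category} (G : Comonad C) {x y : C} (f : Hom x y) :
  extract_at G y ∘ fmap G f = f ∘ extract_at G x.
Proof. apply (ntc_nat (counit G)). Qed.

Lemma extract_duplicate {C : Category} (G : Comonad C) (x : C) :
  extract_at G (G x) ∘ duplicate_at G x = idm (G x).
Proof. apply comul_counitl. Qed.

Lemma fmap_extract_duplicate {C : Category} (G : Comonad C) (x : C) :
  fmap G (extract_at G x) ∘ duplicate_at G x = idm (G x).
Proof. apply comul_counitr. Qed.

Lemma extract_coaction {C : Category} {G : Comonad C} (x : coEM G) :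
  extract_at G (ccarrier x) ∘ coaction x = idm (ccarrier x).
Proof. apply coaction_counit. Qed.

Program Definition cofree {C : Category} (G : Comonad C) : Functor C (coEM G) := {|
  fobj := fun x => {| ccarrier := G x; coaction := comul G x |} : coEM G;
  fmap := fun _ _ f => {| chom := fmap G f |} |}.
Next Obligation. simpl; intros; apply comul_counitl. Qed.
Next Obligation. simpl; intros; apply comul_assoc. Qed.
Next Obligation. simpl; intros C G ? ?; apply (ntc_nat (comul G)). Qed.
Next Obligation. simpl; intros; apply chom_inj, fmap_id. Qed.
Next Obligation. simpl; intros; apply chom_inj, fmap_comp. Qed.

(** The unit at [x] of the adjunction between [coEM_forget G] and [cofree G]. *)
Program Definition coaction_hom {C : Category} {G : Comonad C} (x : coEM G) :
    Hom x (cofree G (ccarrier x)) :=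
  {| chom := coaction x |}.
Next Obligation. simpl; intros; apply coaction_comul. Qed.

(** The comultiplication as a morphism of comodules. Being an instance of [coaction_hom], it
    inherits naturality and coassociativity. *)
Definition cofree_comul {C : Category} (G : Comonad C) (M : C) :
    Hom (cofree G M) (cofree G (G M)) :=
  coaction_hom (cofree G M).

Lemma coaction_hom_nat {C : Category} {G : Comonad C} {x y : coEM G} (f : Hom x y) :
  coaction_hom y ∘ f = fmap (cofree G) (chom f) ∘ coaction_hom x.
Proof. apply chom_inj, (chom_coaction f). Qed.

Lemma cofree_comul_nat {C : Category} (G : Comonad C) {M N : C} (f : Hom M N) :
  cofree_comul G N ∘ fmap (cofree G) f
  = fmap (cofree G) (fmap G f) ∘ cofree_comul G M.
Proof. apply (coaction_hom_nat (fmap (cofree G) f)). Qed.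

(** Naturality of [coaction_hom] at the morphism [coaction_hom x] itself. *)
Lemma coaction_hom_coassoc {C : Category} {G : Comonad C} (x : coEM G) :
  cofree_comul G (ccarrier x) ∘ coaction_hom x
  = fmap (cofree G) (coaction x) ∘ coaction_hom x.
Proof. apply (coaction_hom_nat (coaction_hom x)). Qed.

Lemma cofree_comul_coassoc {C : Category} (G : Comonad C) (M : C) :
  cofree_comul G (G M) ∘ cofree_comul G M
  = fmap (cofree G) (duplicate_at G M) ∘ cofree_comul G M.
Proof. apply (coaction_hom_coassoc (cofree G M)). Qed.

Lemma cofree_comul_extract {C : Category} (G : Comonad C) (M : C) :
  fmap (cofree G) (extract_at G M) ∘ cofree_comul G M = idm (cofree G M).
Proof. apply chom_inj, comul_counitr. Qed.

(** Transposition for the adjunction between [coEM_forget G] and [cofree G], whose counit is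
    [extract_at G]. *)
Definition cotranspose {C : Category} {G : Comonad C} {x : coEM G} {M : C}
    (g : Hom (ccarrier x) M) : Hom x (cofree G M) :=
  fmap (cofree G) g ∘ coaction_hom x.

Lemma extract_cotranspose {C : Category} {G : Comonad C} {x : coEM G} {M : C}
    (g : Hom (ccarrier x) M) :
  extract_at G M ∘ chom (cotranspose g) = g.
Proof.
simpl; now rewrite comp_assoc, extract_nat, <- comp_assoc, extract_coaction, comp_idr.
Qed.

Lemma cotransposeK {C : Category} {G : Comonad C} {x : coEM G} {M : C}
    (h : Hom x (cofree G M)) :
  cotranspose (extract_at G M ∘ chom h) = h.
Proof.
pose (k := chom h : Hom (ccarrier x) (G M)).
apply chom_inj; change (fmap G (extract_at G M ∘ k) ∘ coaction x = k).
assert (E : duplicate_at G M ∘ k = fmap G k ∘ coaction x)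
  by apply (chom_coaction h).
now rewrite fmap_comp, <- comp_assoc, <- E, comp_assoc, fmap_extract_duplicate, comp_idl.
Qed.

Lemma extract_inj {C : Category} {G : Comonad C} {x : coEM G} {M : C}
    (h h' : Hom x (cofree G M)) :
  extract_at G M ∘ chom h = extract_at G M ∘ chom h' -> h = h'.
Proof. now intros E; rewrite <- (cotransposeK h), E, cotransposeK. Qed.

(** By naturality [coaction_hom y ∘ f] is [cotranspose (chom f)], from which the counit of [G]
    recovers [chom f]. *)
Lemma coaction_hom_mono {C : Category} {G : Comonad C} {x y : coEM G} (f g : Hom x y) :
  coaction_hom y ∘ f = coaction_hom y ∘ g -> f = g.
Proof.
rewrite !coaction_hom_nat; intros E; apply chom_inj.
rewrite <- (extract_cotranspose (chom f)); unfold cotranspose.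
now rewrite E; apply (extract_cotranspose (chom g)).
Qed.

(* [coaction_hom y] is the equalizer of the pair in the hypothesis. *)
Lemma coaction_hom_factor {C : Category} {G : Comonad C} {x y : coEM G}
    (f : Hom x (cofree G (ccarrier y))) :
  fmap (cofree G) (coaction y) ∘ f = cofree_comul G (ccarrier y) ∘ f ->
  { g : Hom x y | coaction_hom y ∘ g = f }.
Proof.
(* In [C] the fork is split by the counit: [coaction y ∘ extract_at G _] is
   [extract_at G _ ∘ fmap G (coaction y)], which on [chom f] agrees with
   [extract_at G _ ∘ duplicate_at G _], the identity. *)
intros E; pose (g := extract_at G (ccarrier y) ∘ chom f).
assert (E0 : fmap G (coaction y) ∘ chom f = duplicate_at G (ccarrier y) ∘ chom f)
  by exact (f_equal (fun h => chom h) E).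
assert (E1 : coaction y ∘ g = chom f).
{ unfold g; rewrite comp_assoc, <- extract_nat, <- comp_assoc.
  now rewrite E0, comp_assoc, extract_duplicate, comp_idl. }
(* [f] is the cotranspose of [g], which is exactly compatibility of [g] with the coactions. *)
assert (E2 : coaction y ∘ g = fmap G g ∘ coaction x)
  by (rewrite E1; symmetry; exact (f_equal (fun h => chom h) (cotransposeK f))).
exists (Build_ComoduleHom E2 : Hom x y).
now apply chom_inj.
Qed.

(** * Lifting a left adjoint along cofree comodules *)

(* The left adjoint sends [p] to [I p] with the coaction [theta p] whose adjunct is
   the unit followed by [V] of the comultiplication; since [x] is the equalizer of
   [cofree (coaction x)] and [cofree_comul], a unit of the lifted adjunction exists. *)
Lemma has_left_adjoint_lift {C E : Category} {G : Comonad C} (V : Functor (coEM G) E)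
    (V_mono : forall (p : E) (x : coEM G) (f g : Hom p (V x)),
      fmap V (coaction_hom x) ∘ f = fmap V (coaction_hom x) ∘ g -> f = g)
    (V_factor : forall (p : E) (x : coEM G) (f : Hom p (V (cofree G (ccarrier x)))),
      fmap V (fmap (cofree G) (coaction x)) ∘ f
      = fmap V (cofree_comul G (ccarrier x)) ∘ f ->
      { g : Hom p (V x) | fmap V (coaction_hom x) ∘ g = f }) :
  has_left_adjoint (V ⊙ cofree G) -> has_left_adjoint V.
Proof.
intros [I [adj]].
pose (u := fun p => unit_at adj p : Hom p (V (cofree G (I p)))).
pose (tr := fun p M (f : Hom p (V (cofree G M))) => transpose adj f : Hom (I p) M).
assert (tr_u : forall p M f, fmap V (fmap (cofree G) (tr p M f)) ∘ u p = f)
  by (intros; apply (transpose_unit adj)).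
assert (u_inj : forall p M (g g' : Hom (I p) M),
    fmap V (fmap (cofree G) g) ∘ u p = fmap V (fmap (cofree G) g') ∘ u p -> g = g')
  by (intros; now apply (unit_inj adj)).
clearbody u tr.
pose (theta := fun p => tr p (G (I p)) (fmap V (cofree_comul G (I p)) ∘ u p)).
assert (theta_u : forall p, fmap V (fmap (cofree G) (theta p)) ∘ u p
    = fmap V (cofree_comul G (I p)) ∘ u p) by (intros; apply tr_u).
clearbody theta.
(* Both comodule laws are tested against the universal arrow [u p], where [theta_u] replaces
   [theta p] by [cofree_comul] and the laws become those of the comonad. *)
assert (theta_counit : forall p, extract_at G (I p) ∘ theta p = idm (I p)).
{ intros p; apply u_inj.
  now rewrite !fmap_comp, <- comp_assoc, theta_u, comp_assoc, <- fmap_comp,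
    cofree_comul_extract, !fmap_id. }
assert (theta_comul : forall p, duplicate_at G (I p) ∘ theta p = fmap G (theta p) ∘ theta p).
{ intros p; apply u_inj.
  rewrite !fmap_comp, <- !comp_assoc, theta_u, !comp_assoc, <- !fmap_comp.
  rewrite <- cofree_comul_nat, <- cofree_comul_coassoc, !fmap_comp, <- !comp_assoc; f_equal.
  symmetry; apply theta_u. }
pose (L := fun p => {| ccarrier := I p; coaction := theta p;
  coaction_counit := theta_counit p; coaction_comul := theta_comul p |} : coEM G).
(* [theta_u] says that [u p] equalizes the pair presenting [L p], so it factors through
   [V (L p)]. *)
assert (eta : forall p, { w : Hom p (V (L p)) | fmap V (coaction_hom (L p)) ∘ w = u p })
  by (intros p; apply V_factor, theta_u).
(* This reduces the universal property of [eta p] to that of [u p]. *)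
assert (lift_eq : forall p x (g : Hom (L p) x),
    fmap V (coaction_hom x) ∘ (fmap V g ∘ proj1_sig (eta p))
    = fmap V (fmap (cofree G) (chom g)) ∘ u p).
{ intros p x g.
  now rewrite comp_assoc, <- fmap_comp, coaction_hom_nat, fmap_comp, <- comp_assoc,
    (proj2_sig (eta p)). }
(* The carrier of the transpose of [f]; it respects coactions because [coaction_hom x] equalizes its
   pair. *)
pose (g0 := fun p x (f : Hom p (V x)) => tr p (ccarrier x) (fmap V (coaction_hom x) ∘ f)).
assert (g0_hom : forall p x (f : Hom p (V x)),
    coaction x ∘ g0 p x f = fmap G (g0 p x f) ∘ theta p).
{ intros p x f; apply u_inj; unfold g0.
  rewrite !fmap_comp, <- !comp_assoc, tr_u, theta_u, !comp_assoc, <- !fmap_comp.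
  rewrite <- cofree_comul_nat, <- coaction_hom_coassoc, !fmap_comp, <- !comp_assoc; f_equal.
  symmetry; apply tr_u. }
apply (has_left_adjoint_of_universal V L (fun p => proj1_sig (eta p))
  (fun p x f => Build_ComoduleHom (M := L p) (g0_hom p x f))).
- intros p x f; apply V_mono; rewrite lift_eq; apply tr_u.
- intros p x g g' E0; apply chom_inj, u_inj.
  now rewrite <- !lift_eq, E0.
Qed.

(** * The comparison functor and the equalizers of cofree comodules *)

(** A right adjoint preserves monomorphisms: transpose and cancel [coaction_hom x] among
    comodules. *)
Lemma fmap_coaction_hom_mono {A C : Category} {G : Comonad C} {K : Functor A (coEM G)}
    {Kbar : Functor (coEM G) A} (adj : Adjunction K Kbar) {a : A} {x : coEM G}
    (f g : Hom a (Kbar x)) :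
  fmap Kbar (coaction_hom x) ∘ f = fmap Kbar (coaction_hom x) ∘ g -> f = g.
Proof.
intros E; apply (transpose_inj adj), coaction_hom_mono.
now rewrite <- !transpose_comp, E.
Qed.

(** The transpose of the carrier of [f] factors through the equalizer of comodules; transposing back
    gives the factorization in [A]. *)
Lemma comparison_coaction_factor {A C : Category} {G : Comonad C}
    {K : Functor A (coEM G)} {Kbar : Functor (coEM G) A} (adj : Adjunction K Kbar)
    {p : EM (adj_monad adj)} {x : coEM G}
    (f : Hom p (comparison adj (cofree G (ccarrier x)))) :
  fmap (comparison adj) (fmap (cofree G) (coaction x)) ∘ f
  = fmap (comparison adj) (cofree_comul G (ccarrier x)) ∘ f ->
  { g : Hom p (comparison adj x) | fmap (comparison adj) (coaction_hom x) ∘ g = f }.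
Proof.
intros E.
pose (f0 := mhom f : Hom (mcarrier p) (Kbar (cofree G (ccarrier x)))).
pose (act := maction p : Hom (Kbar (K (mcarrier p))) (mcarrier p)).
assert (f0_act : f0 ∘ act = fmap Kbar (counit_at adj _) ∘ fmap Kbar (fmap K f0))
  by exact (mhom_action f).
assert (E0 : fmap Kbar (fmap (cofree G) (coaction x)) ∘ f0
    = fmap Kbar (cofree_comul G (ccarrier x)) ∘ f0)
  by exact (f_equal (fun h => mhom h) E).
destruct (coaction_hom_factor (transpose adj f0)) as [g g_eq];
  [now rewrite <- !transpose_comp, E0|].
pose (w := fmap Kbar g ∘ unit_at adj (mcarrier p)).
assert (w_eq : fmap Kbar (coaction_hom x) ∘ w = f0).
{ apply (transpose_inj adj); unfold w; now rewrite transpose_comp, transposeK. }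
(* Compatibility with the actions may be checked after the monomorphism
   [fmap Kbar (coaction_hom x)], where it is that of [f]. *)
assert (w_act : w ∘ act = fmap Kbar (counit_at adj x) ∘ fmap Kbar (fmap K w)).
{ apply (fmap_coaction_hom_mono adj).
  rewrite !comp_assoc, w_eq, f0_act, <- w_eq, <- !fmap_comp.
  now rewrite (fmap_comp K), comp_assoc, counit_nat. }
exists (Build_ModuleHom (M := p) (N := comparison adj x) w_act).
apply mhom_inj, w_eq.
Qed.

Lemma has_left_adjoint_comparison {A C : Category} {G : Comonad C}
    {K : Functor A (coEM G)} {Kbar : Functor (coEM G) A} (adj : Adjunction K Kbar) :
  has_left_adjoint (comparison adj ⊙ cofree G) -> has_left_adjoint (comparison adj).
Proof.
apply has_left_adjoint_lift.
- intros p x f g E; apply mhom_inj, (fmap_coaction_hom_mono adj).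
  exact (f_equal (fun h => mhom h) E).
- intros p x; apply comparison_coaction_factor.
Qed.

(** * Comparison on cofree comodules is restriction of base *)

(** The counit at [M] of the free-forgetful adjunction of [T]. *)
Definition action_hom {C : Category} {T : Monad C} (M : EM T) :
    Hom (EM_free T (mcarrier M)) M :=
  Build_ModuleHom (M := EM_free T (mcarrier M)) (maction_mul M).

(** On carriers this compares two right adjoints of [EM_free T]: [Kbar ⊙ cofree G], by [eK], and
    [EM_forget T]. *)
Definition cofree_mate {A : Category} {T : Monad A} {G : Comonad (EM T)}
    {K : Functor A (coEM G)} (eK : coEM_forget G ⊙ K = EM_free T)
    {Kbar : Functor (coEM G) A} (adj : Adjunction K Kbar) (M : EM T) :
    Hom (comparison adj (cofree G M)) (restriction (iota eK adj) M) :=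
  fmap (restriction (iota eK adj)) (extract_at G M) ∘ mate eK adj (cofree G M).

Lemma cofree_mate_nat {A : Category} {T : Monad A} {G : Comonad (EM T)}
    {K : Functor A (coEM G)} (eK : coEM_forget G ⊙ K = EM_free T)
    {Kbar : Functor (coEM G) A} (adj : Adjunction K Kbar) {M N : EM T} (f : Hom M N) :
  cofree_mate eK adj N ∘ fmap (comparison adj) (fmap (cofree G) f)
  = fmap (restriction (iota eK adj)) f ∘ cofree_mate eK adj M.
Proof.
pose (R := restriction (iota eK adj)).
pose (mu := fun L => mate eK adj (cofree G L)
  : Hom (comparison adj (cofree G L)) (R (G L))).
assert (E : mu N ∘ fmap (comparison adj) (fmap (cofree G) f) = fmap R (fmap G f) ∘ mu M)
  by exact (ntc_nat (mate eK adj) (fmap (cofree G) f)).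
change (fmap R (extract_at G N) ∘ mu N ∘ fmap (comparison adj) (fmap (cofree G) f)
  = fmap R f ∘ (fmap R (extract_at G M) ∘ mu M)).
rewrite <- comp_assoc, E, !comp_assoc; f_equal.
rewrite <- !fmap_comp; f_equal; apply extract_nat.
Qed.

(** The counit of the free-forgetful adjunction, read through [eK] and transposed to comodules;
    transposing once more along [adj] gives the inverse of [cofree_mate]. *)
Definition cofree_lift {A : Category} {T : Monad A} {G : Comonad (EM T)}
    {K : Functor A (coEM G)} (eK : coEM_forget G ⊙ K = EM_free T)
    (M : EM T) : Hom (K (mcarrier M)) (cofree G M) :=
  cotranspose (action_hom M ∘ eq_nat eK (mcarrier M)).

Definition extract_map {A : Category} {T : Monad A} (G : Comonad (EM T)) (M : EM T) :
    Hom (Defs.U G (cofree G M)) (mcarrier M) :=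
  mhom (extract_at G M).

Lemma extract_cofree_lift {A : Category} {T : Monad A} {G : Comonad (EM T)}
    {K : Functor A (coEM G)} (eK : coEM_forget G ⊙ K = EM_free T)
    (M : EM T) :
  extract_map G M ∘ fmap (Defs.U G) (cofree_lift eK M)
  = maction M ∘ Defs.toT eK (mcarrier M).
Proof.
exact (f_equal (fun h => mhom h)
  (extract_cotranspose (action_hom M ∘ eq_nat eK (mcarrier M)))).
Qed.

Definition cofree_mate_inv {A : Category} {T : Monad A} {G : Comonad (EM T)}
    {K : Functor A (coEM G)} (eK : coEM_forget G ⊙ K = EM_free T)
    {Kbar : Functor (coEM G) A} (adj : Adjunction K Kbar) (M : EM T) :
    Hom (mcarrier M) (Kbar (cofree G M)) :=
  fmap Kbar (cofree_lift eK M) ∘ unit_at adj (mcarrier M).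

Lemma mate_map_unit {A : Category} {T : Monad A} {G : Comonad (EM T)}
    {K : Functor A (coEM G)} (eK : coEM_forget G ⊙ K = EM_free T)
    {Kbar : Functor (coEM G) A} (adj : Adjunction K Kbar) (a : A) :
  Defs.mt eK adj (K a) ∘ unit_at adj a = Defs.ofT eK a ∘ Defs.e T a.
Proof.
rewrite <- (Defs.iota_map_unit eK adj), Defs.iota_mapE, !comp_assoc, Defs.ofTK.
now rewrite comp_idl.
Qed.

(** Naturality moves the mate from [cofree G M] to [K (mcarrier M)], where [mate_map_unit] leaves
    the unit law of [M]. *)
Lemma cofree_mateK {A : Category} {T : Monad A} {G : Comonad (EM T)}
    {K : Functor A (coEM G)} (eK : coEM_forget G ⊙ K = EM_free T)
    {Kbar : Functor (coEM G) A} (adj : Adjunction K Kbar) (M : EM T) :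
  mhom (cofree_mate eK adj M) ∘ cofree_mate_inv eK adj M = idm (mcarrier M).
Proof.
change (extract_map G M ∘ Defs.mt eK adj (cofree G M)
  ∘ (fmap Kbar (cofree_lift eK M) ∘ unit_at adj (mcarrier M)) = idm (mcarrier M)).
rewrite !comp_assoc, <- (comp_assoc _ (Defs.mt _ _ _)), Defs.mt_nat.
rewrite comp_assoc, extract_cofree_lift, <- !comp_assoc, mate_map_unit.
rewrite (comp_assoc (Defs.toT _ _)), Defs.toTK, comp_idl.
exact (maction_unit M).
Qed.

Lemma cofree_mate_invK {A : Category} {T : Monad A} {G : Comonad (EM T)}
    {K : Functor A (coEM G)} (eK : coEM_forget G ⊙ K = EM_free T)
    {Kbar : Functor (coEM G) A} (adj : Adjunction K Kbar) (M : EM T) :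
  cofree_mate_inv eK adj M ∘ mhom (cofree_mate eK adj M) = idm (Kbar (cofree G M)).
Proof.
pose (b := extract_map G M ∘ Defs.mt eK adj (cofree G M)).
change (fmap Kbar (cofree_lift eK M) ∘ unit_at adj (mcarrier M) ∘ b
  = idm (Kbar (cofree G M))).
rewrite <- comp_assoc, unit_nat, comp_assoc, <- fmap_comp.
apply (transpose_inj adj); rewrite transposeK.
unfold transpose; rewrite fmap_id, comp_idr.
apply extract_inj, mhom_inj.
change (extract_map G M
    ∘ (fmap (Defs.U G) (cofree_lift eK M) ∘ fmap (Defs.U G) (fmap K b))
  = extract_map G M ∘ fmap (Defs.U G) (Defs.s adj (cofree G M))).
rewrite comp_assoc, extract_cofree_lift, <- comp_assoc, Defs.toT_nat; unfold b.
assert (E : extract_map G M ∘ Defs.act (cofree G M) = maction M ∘ fmap T (extract_map G M))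
  by exact (mhom_action (extract_at G M)).
rewrite fmap_comp, !comp_assoc, <- E, <- (comp_assoc _ (Defs.act _)), Defs.mate_ext.
now rewrite <- !comp_assoc, Defs.ofTK, comp_idr.
Qed.

(** The forgetful functor of modules reflects isomorphisms; hence [cofree_mate_inv] can be built in
    [A] alone. *)
Lemma module_inverse_action {C : Category} {T : Monad C} {M N : EM T} (f : Hom M N)
    (g : Hom (mcarrier N) (mcarrier M)) :
  g ∘ mhom f = idm (mcarrier M) -> mhom f ∘ g = idm (mcarrier N) ->
  g ∘ maction N = maction M ∘ fmap T g.
Proof.
intros gf fg.
rewrite <- (comp_idl (maction M ∘ _)), <- gf, <- comp_assoc, (comp_assoc (mhom f)).
now rewrite mhom_action, <- comp_assoc, <- fmap_comp, fg, fmap_id, comp_idr.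
Qed.

Definition cofree_mate_inv_hom {A : Category} {T : Monad A} {G : Comonad (EM T)}
    {K : Functor A (coEM G)} (eK : coEM_forget G ⊙ K = EM_free T)
    {Kbar : Functor (coEM G) A} (adj : Adjunction K Kbar) (M : EM T) :
    Hom (restriction (iota eK adj) M) (comparison adj (cofree G M)) :=
  Build_ModuleHom (M := restriction (iota eK adj) M) (N := comparison adj (cofree G M))
    (module_inverse_action (T := adj_monad adj)
       (M := comparison adj (cofree G M)) (N := restriction (iota eK adj) M)
       (cofree_mate eK adj M) (cofree_mate_inv eK adj M)
       (cofree_mate_invK eK adj M) (cofree_mateK eK adj M)).

Lemma cofree_mate_hom_invK {A : Category} {T : Monad A} {G : Comonad (EM T)}
    {K : Functor A (coEM G)} (eK : coEM_forget G ⊙ K = EM_free T)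
    {Kbar : Functor (coEM G) A} (adj : Adjunction K Kbar) (M : EM T) :
  cofree_mate_inv_hom eK adj M ∘ cofree_mate eK adj M
  = idm (comparison adj (cofree G M)).
Proof. apply mhom_inj; exact (cofree_mate_invK eK adj M). Qed.

Lemma cofree_mate_homK {A : Category} {T : Monad A} {G : Comonad (EM T)}
    {K : Functor A (coEM G)} (eK : coEM_forget G ⊙ K = EM_free T)
    {Kbar : Functor (coEM G) A} (adj : Adjunction K Kbar) (M : EM T) :
  cofree_mate eK adj M ∘ cofree_mate_inv_hom eK adj M
  = idm (restriction (iota eK adj) M).
Proof. apply mhom_inj; exact (cofree_mateK eK adj M). Qed.

Lemma cofree_mate_inv_nat {A : Category} {T : Monad A} {G : Comonad (EM T)}
    {K : Functor A (coEM G)} (eK : coEM_forget G ⊙ K = EM_free T)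
    {Kbar : Functor (coEM G) A} (adj : Adjunction K Kbar) {M N : EM T} (f : Hom M N) :
  cofree_mate_inv_hom eK adj N ∘ fmap (restriction (iota eK adj)) f
  = fmap (comparison adj) (fmap (cofree G) f) ∘ cofree_mate_inv_hom eK adj M.
Proof.
rewrite <- (comp_idr (fmap (restriction _) f)), <- (cofree_mate_homK eK adj M).
rewrite (comp_assoc (fmap _ _)), <- cofree_mate_nat, !comp_assoc, cofree_mate_hom_invK.
now rewrite comp_idl.
Qed.

Definition restriction_iso {A : Category} {T : Monad A} {G : Comonad (EM T)}
    {K : Functor A (coEM G)} (eK : coEM_forget G ⊙ K = EM_free T)
    {Kbar : Functor (coEM G) A} (adj : Adjunction K Kbar) :
    NatIso (comparison adj ⊙ cofree G) (restriction (iota eK adj)) := {|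
  iso_to := Build_NatTrans (F := comparison adj ⊙ cofree G)
    (@cofree_mate_nat _ _ _ _ eK _ adj);
  iso_from := Build_NatTrans (G := comparison adj ⊙ cofree G)
    (@cofree_mate_inv_nat _ _ _ _ eK _ adj);
  iso_from_to := cofree_mate_hom_invK eK adj;
  iso_to_from := cofree_mate_homK eK adj |}.

(** * The left adjoint of restriction of base *)

(** [LP] is left adjoint to [comparison adj] and [coEM_forget G] to [cofree G], so the composite is
    left adjoint to [comparison adj ⊙ cofree G], which is isomorphic to restriction. Building it
    from a universal arrow makes the unit the stated one. *)
Lemma forget_left_adjoint {A : Category} {T : Monad A} {G : Comonad (EM T)}
    {K : Functor A (coEM G)} (eK : coEM_forget G ⊙ K = EM_free T)
    {Kbar : Functor (coEM G) A} (adj : Adjunction K Kbar)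
    (LP : Functor (EM (adj_monad adj)) (coEM G)) (adjL : Adjunction LP (comparison adj)) :
  exists adjU : Adjunction (coEM_forget G ⊙ LP) (restriction (iota eK adj)),
    forall p, adj_unit adjU p = mate eK adj (LP p) ∘ adj_unit adjL p.
Proof.
pose (R := restriction (iota eK adj)).
pose (mu := fun x => mate eK adj x : Hom (comparison adj x) (R (ccarrier x))).
assert (mu_nat : forall x y (f : Hom x y),
    mu y ∘ fmap (comparison adj) f = fmap R (chom f) ∘ mu x)
  by (intros x y f; apply (ntc_nat (mate eK adj) f)).
pose (eta := fun p => mu (LP p) ∘ unit_at adjL p : Hom p (R (ccarrier (LP p)))).
assert (eta_nat : forall p q (f : Hom p q),
    eta q ∘ f = fmap R (chom (fmap LP f)) ∘ eta p).
{ intros p q f; unfold eta.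
  now rewrite <- comp_assoc, unit_nat, !comp_assoc, mu_nat. }
(* This identifies transposition along [eta] with cotransposition, transposition along [adjL] and
   [cofree_mate] in succession. *)
assert (eta_eq : forall p M (h : Hom (LP p) (cofree G M)),
    fmap R (extract_at G M ∘ chom h) ∘ eta p
    = cofree_mate eK adj M ∘ (fmap (comparison adj) h ∘ unit_at adjL p)).
{ intros p M h; unfold eta.
  change (cofree_mate eK adj M) with (fmap R (extract_at G M) ∘ mu (cofree G M)).
  rewrite fmap_comp, <- !comp_assoc; f_equal.
  now rewrite !comp_assoc, mu_nat. }
apply (adjunction_of_universal (coEM_forget G ⊙ LP) R
  (Build_NatTrans (F := id_functor _) (G := R ⊙ (coEM_forget G ⊙ LP)) eta_nat)
  (fun p M f =>
    extract_at G M ∘ chom (transpose adjL (cofree_mate_inv_hom eK adj M ∘ f)))).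
- intros p M f.
  change (fmap R (extract_at G M
    ∘ chom (transpose adjL (cofree_mate_inv_hom eK adj M ∘ f))) ∘ eta p = f).
  rewrite eta_eq, transpose_unit, comp_assoc, cofree_mate_homK.
  apply comp_idl.
- intros p M g g' E.
  change (fmap R g ∘ eta p = fmap R g' ∘ eta p) in E.
  (* Writing [g] and [g'] through their cotransposes makes [eta_eq] applicable; [cofree_mate] is
     then cancelled by its inverse. *)
  rewrite <- (extract_cotranspose g), <- (extract_cotranspose g'), !eta_eq in E.
  rewrite <- (extract_cotranspose g), <- (extract_cotranspose g').
  do 2 f_equal; apply (unit_inj adjL).
  rewrite <- (comp_idl (fmap _ (cotranspose g) ∘ _)), <- (cofree_mate_hom_invK eK adj M).
  now rewrite <- comp_assoc, E, comp_assoc, cofree_mate_hom_invK, comp_idl.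
Qed.

Theorem proposition4p6 :
  forall (A : Category) (T : Monad A) (G : Comonad (EM T))
    (K : Functor A (coEM G)) (eK : coEM_forget G ⊙ K = EM_free T)
    (Kbar : Functor (coEM G) A) (adj : Adjunction K Kbar),
  (has_left_adjoint (comparison adj) <-> has_left_adjoint (restriction (iota eK adj)))
  /\
  (forall (LP : Functor (EM (adj_monad adj)) (coEM G))
      (adjL : Adjunction LP (comparison adj)),
    exists adjU : Adjunction (coEM_forget G ⊙ LP) (restriction (iota eK adj)),
      (forall p, adj_unit adjU p = mate eK adj (LP p) ∘ adj_unit adjL p) /\
      (forall (iota_shriek : Functor (EM (adj_monad adj)) (EM T))
          (adjI : Adjunction iota_shriek (restriction (iota eK adj))),
        exists alpha : NatIso iota_shriek (coEM_forget G ⊙ LP),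
          forall p, fmap (restriction (iota eK adj)) (alpha p) ∘ adj_unit adjI p
                    = adj_unit adjU p)).
Proof.
intros A T G K eK Kbar adj; split; [split|].
- intros [LP [adjL]]; destruct (forget_left_adjoint eK adj LP adjL) as [adjU _].
  now exists (coEM_forget G ⊙ LP); constructor.
(* The isomorphism moves the left adjoint of restriction to [comparison adj ⊙ cofree G], from where
   it lifts. *)
- intros H; apply has_left_adjoint_comparison.
  exact (has_left_adjoint_iso (restriction_iso eK adj) H).
- intros LP adjL; destruct (forget_left_adjoint eK adj LP adjL) as [adjU unitU].
  exists adjU; split; [exact unitU|].
  intros iota_shriek adjI; apply left_adjoint_unique.
Qed.
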